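(* Let $n\ge 3$ be an integer and let $r$ be an integer with $1\le r\le \max\left(1,\lfloor \frac{n}{2}\rfloor-2\right)$. Then $BS(1,n)$ has a positive density of elements $g$ with $\kappa_r(g)<0$; that is, there is a set $\mathcal{A}\subset BS(1,n)$ of positive density in $BS(1,n)$ such that $\kappa_r(g)<0$ for every $g\in\mathcal{A}$.
   Context: $BS(1,n)=\langle t,a \mid tat^{-1}=a^n\rangle$. Word length $l(\cdot)$ is always with respect to the generating set $\{a,t\}$ (i.e. letters $a^{\pm1},t^{\pm1}$). $S_n(r)$ denotes the sphere of radius $r$ centered at the identity in $BS(1,n)$, i.e. the set of elements of word length exactly $r$. For $g\ne e$ and an integer $r\ge 1$, the conjugation curvature is $$\kappa_r(g)=\frac{l(g)-\frac{1}{|S_n(r)|}\sum_{p\in S_n(r)} l(p^{-1}gp)}{l(g)}.$$ For $\mathcal{A}\subset BS(1,n)$ let $\mathcal{A}(N)$ be the set of elements of $\mathcal{A}$ of word length $N$. The set $\mathcal{A}$ has positive density in $BS(1,n)$ if there is $\epsilon>0$ such that for all sufficiently large $N$, $\epsilon<\frac{|\mathcal{A}(N)|}{|S_n(N)|}<1-\epsilon$. *)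

(* Defs.v *)
From HB Require Import structures.
From mathcomp Require Import all_boot all_order all_algebra.
From mathcomp Require Import finmap.
From mathcomp Require Import boolp classical_sets functions cardinality reals.

Set Implicit Arguments.
Unset Strict Implicit.
Unset Printing Implicit Defensive.

Import Order.TTheory GRing.Theory Num.Theory.

(* A letter is a pair (generator, sign): the generator is [t] if the first
   component is true and [a] otherwise, and the letter is its inverse if the
   second component is true. *)
Definition letter : Type := bool * bool.
Definition word : Type := seq letter.

Definition let_a : letter := (false, false).
Definition let_a' : letter := (false, true).
Definition let_t : letter := (true, false).
Definition let_t' : letter := (true, true).

Definition linv (x : letter) : letter := (x.1, ~~ x.2).
Definition winv (w : word) : word := rev (map linv w).

(* Equality of words in < t, a | t a t^-1 = a^n >: the least equivalence
   relation allowing free cancellation and the defining relation inside words. *)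
Inductive bs_eqv (n : nat) : word -> word -> Prop :=
| bs_refl w : bs_eqv n w w
| bs_sym w1 w2 : bs_eqv n w1 w2 -> bs_eqv n w2 w1
| bs_trans w2 w1 w3 : bs_eqv n w1 w2 -> bs_eqv n w2 w3 -> bs_eqv n w1 w3
| bs_cancel u v x : bs_eqv n (u ++ [:: x; linv x] ++ v) (u ++ v)
| bs_relator u v : bs_eqv n (u ++ [:: let_t; let_a; let_t'] ++ v) (u ++ nseq n let_a ++ v).

Definition bs_eqvb (n : nat) : rel word := fun w1 w2 => `[< bs_eqv n w1 w2 >].

Lemma bs_eqvb_refl n : reflexive (bs_eqvb n).
Proof. by move=> w; apply/asboolP; exact: bs_refl. Qed.

Lemma bs_eqvb_sym n : symmetric (bs_eqvb n).
Proof. by move=> w1 w2; apply/asboolP/asboolP; exact: bs_sym. Qed.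

Lemma bs_eqvb_trans n : transitive (bs_eqvb n).
Proof.
by move=> w2 w1 w3 /asboolP h1 /asboolP h2; apply/asboolP; exact: bs_trans h1 h2.
Qed.

Canonical bs_equiv n :=
  EquivRel (bs_eqvb n) (bs_eqvb_refl n) (@bs_eqvb_sym n) (@bs_eqvb_trans n).

Definition BS (n : nat) : Type := {eq_quot (bs_equiv n)}%qT.
HB.instance Definition _ n := Choice.on (BS n).
HB.instance Definition _ n := Quotient.on (BS n).

Definition bs_class (n : nat) (w : word) : BS n := (\pi_(BS n) w)%qT.

Lemma bs_classP n w1 w2 : bs_class n w1 = bs_class n w2 <-> bs_eqv n w1 w2.
Proof.
split; first by move=> h; apply/asboolP/(@eqmodP _ (bs_equiv n)).
by move=> h; apply/(@eqmodP _ (bs_equiv n))/asboolP.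
Qed.

Lemma bs_classK n (g : BS n) : bs_class n (repr g) = g.
Proof. exact: reprK. Qed.

Section Congruence.
Variable n : nat.

Lemma linvK : involutive linv.
Proof. by case=> x y; rewrite /linv /= negbK. Qed.

Lemma winvK : involutive winv.
Proof. by move=> w; rewrite /winv map_rev revK mapK //; exact: linvK. Qed.

Lemma winv_cat u v : winv (u ++ v) = winv v ++ winv u.
Proof. by rewrite /winv map_cat rev_cat. Qed.

Lemma bs_eqv_ctx u v w1 w2 :
  bs_eqv n w1 w2 -> bs_eqv n (u ++ w1 ++ v) (u ++ w2 ++ v).
Proof.
elim=> {w1 w2} [w|w1 w2 _|w2 w1 w3 _ h1 _ h2|u' v' x|u' v'].
- exact: bs_refl.
- exact: bs_sym.
- exact: bs_trans h1 h2.
- have := bs_cancel n (u ++ u') (v' ++ v) x.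
  by rewrite -!catA.
- have := bs_relator n (u ++ u') (v' ++ v).
  by rewrite -!catA.
Qed.

Lemma bs_eqv_cat u1 u2 v1 v2 :
  bs_eqv n u1 u2 -> bs_eqv n v1 v2 -> bs_eqv n (u1 ++ v1) (u2 ++ v2).
Proof.
move=> /(bs_eqv_ctx [::] v1) /= hu /(bs_eqv_ctx u2 [::]).
by rewrite !cats0; exact: bs_trans.
Qed.

Lemma bs_eqv_mulV w : bs_eqv n (w ++ winv w) [::].
Proof.
elim: w => [|x w IH]; first exact: bs_refl.
rewrite -cat1s winv_cat -catA (catA w).
apply: bs_trans (bs_eqv_ctx _ _ IH) _ => /=.
exact: (bs_cancel n [::] [::] x).
Qed.

Lemma bs_eqv_Vmul w : bs_eqv n (winv w ++ w) [::].
Proof. by rewrite -{2}(winvK w); exact: bs_eqv_mulV. Qed.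

Lemma bs_eqv_inv u v : bs_eqv n u v -> bs_eqv n (winv u) (winv v).
Proof.
move=> h.
have h1 : bs_eqv n (winv u ++ v ++ winv v) (winv u).
  by rewrite -[X in bs_eqv _ _ X]cats0; apply: bs_eqv_cat (bs_refl _ _) _;
     exact: bs_eqv_mulV.
have h2 : bs_eqv n (winv u ++ v ++ winv v) (winv v).
  apply: bs_trans (bs_eqv_ctx _ _ (bs_sym h)) _.
  by rewrite catA -[X in bs_eqv _ _ X]cat0s; apply: bs_eqv_cat (bs_refl _ _);
     exact: bs_eqv_Vmul.
exact: bs_trans (bs_sym h1) h2.
Qed.

End Congruence.

Section GroupStructure.
Variable n : nat.
Implicit Types g h : BS n.

Definition bs_one : BS n := bs_class n [::].
Definition bs_inv g : BS n := bs_class n (winv (repr g)).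
Definition bs_mul g h : BS n := bs_class n (repr g ++ repr h).

Lemma bs_mul_class u v :
  bs_mul (bs_class n u) (bs_class n v) = bs_class n (u ++ v).
Proof. by apply/bs_classP/bs_eqv_cat; apply/bs_classP; exact: bs_classK. Qed.

Lemma bs_inv_class u : bs_inv (bs_class n u) = bs_class n (winv u).
Proof. by apply/bs_classP/bs_eqv_inv/bs_classP; exact: bs_classK. Qed.

Lemma bs_mulA : associative bs_mul.
Proof.
move=> g h l; rewrite -(bs_classK g) -(bs_classK h) -(bs_classK l).
by rewrite !bs_mul_class catA.
Qed.

Lemma bs_mul1 : left_id bs_one bs_mul.
Proof. by move=> g; rewrite -(bs_classK g) bs_mul_class. Qed.

Lemma bs_mul1r : right_id bs_one bs_mul.
Proof. by move=> g; rewrite -(bs_classK g) bs_mul_class cats0. Qed.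

Lemma bs_mulV : left_inverse bs_one bs_inv bs_mul.
Proof.
move=> g; rewrite -(bs_classK g) bs_inv_class bs_mul_class.
by apply/bs_classP; exact: bs_eqv_Vmul.
Qed.

Lemma bs_mulVr : right_inverse bs_one bs_inv bs_mul.
Proof.
move=> g; rewrite -(bs_classK g) bs_inv_class bs_mul_class.
by apply/bs_classP; exact: bs_eqv_mulV.
Qed.

HB.instance Definition _ :=
  isGroup.Build (BS n) bs_mulA bs_mul1 bs_mul1r bs_mulV bs_mulVr.

Lemma bs_mulE u v : (bs_class n u * bs_class n v)%g = bs_class n (u ++ v).
Proof. exact: bs_mul_class. Qed.

Lemma bs_invE u : ((bs_class n u)^-1)%g = bs_class n (winv u).
Proof. exact: bs_inv_class. Qed.

Lemma bs_relation :
  let a := bs_class n [:: let_a] in let t := bs_class n [:: let_t] in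
  (t * a * t^-1 = a ^+ n)%g.
Proof.
have aX m : ((bs_class n [:: let_a]) ^+ m)%g = bs_class n (nseq m let_a).
  by elim: m => [|m IH] //; rewrite expgS IH bs_mulE.
rewrite /= aX bs_invE !bs_mulE; apply/bs_classP.
by have := bs_relator n [::] [::]; rewrite /= cats0.
Qed.

Lemma bs_length_subproof g :
  exists k, `[< exists2 w : word, size w = k & bs_class n w = g >].
Proof.
by exists (size (repr g)); apply/asboolP; exists (repr g) => //; exact: bs_classK.
Qed.

(* Word length with respect to {a, t}. *)
Definition bs_length g : nat := ex_minn (bs_length_subproof g).

Definition sphere (r : nat) : set (BS n) := [set g | bs_length g = r]%classic.

Lemma finite_sphere r : finite_set (sphere r).
Proof.
pose f (w : r.-tuple letter) := bs_class n w.
apply: (@sub_finite_set _ _ (f @` setT)%classic); last first.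
  exact/finite_image/finite_finset.
move=> g; rewrite /sphere /= /bs_length.
case: ex_minnP => m /asboolP[w sw wg] _ mr.
have sw' : size w == r by rewrite sw mr.
by exists (Tuple sw').
Qed.

Definition slice (A : set (BS n)) (N : nat) : set (BS n) :=
  (A `&` sphere N)%classic.

Section Real.
Variable R : realType.
Local Open Scope ring_scope.

(* The cardinality [#|` fset_set X|] and the sum over [fset_set X] are
   meaningful for finite [X]; spheres are finite by [finite_sphere].
   At [g = 1], where [bs_length g = 0], the value is [0] by convention. *)
Definition conj_curvature (r : nat) (g : BS n) : R :=
  ((bs_length g)%:R
   - (#|` fset_set (sphere r)|)%:R^-1
     * \sum_(p <- fset_set (sphere r)) (bs_length (p^-1 * g * p)%g)%:R)
  / (bs_length g)%:R.

Definition positive_density (A : set (BS n)) : Prop :=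
  exists eps : R, 0 < eps /\
    exists N0 : nat, forall N : nat, (N0 <= N)%N ->
      eps < (#|` fset_set (slice A N)|)%:R / (#|` fset_set (sphere N)|)%:R
          < 1 - eps.

End Real.

End GroupStructure.

(* Main.v *)
Require Import Defs.
From HB Require Import structures.
From mathcomp Require Import all_boot all_order all_algebra.
From mathcomp Require Import finmap zify ring lra.
From mathcomp Require Import boolp classical_sets functions cardinality reals.

Set Implicit Arguments.
Unset Strict Implicit.
Unset Printing Implicit Defensive.

Import Order.TTheory GRing.Theory Num.Theory.

Local Open Scope ring_scope.

(** The conjugation curvature of [g] is negative as soon as [g] is a shortest
    element of its conjugacy class and some element of the sphere of radius [r]
    conjugates it to a strictly longer one: every term of the average is then at
    least the length of [g], and one is larger. So it is enough to find positively
    many elements of this kind, and one family serves all radii [r] at once.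

    In BS(1,n) = Z[1/n] x| Z the element [a^y t^K] is the pair (y, K), and a word
    describes a way to write the first coordinate as a sum of signed powers of
    [n] while a cursor travels along Z: its length is the number of these powers
    plus the distance travelled ([normal_formP]). Let [D y] ([min_cost]) be the
    least number of signed powers of [n] with sum [y]. Take [y] not divisible by
    [n] with |y| < n^(K-1) (the set [long_ascents]). A conjugate of (y, K) still
    has second coordinate [K], and its first coordinate agrees with [y] modulo
    n^K - 1 up to a power of [n]; so a word for it yields, after its digits are
    wrapped around modulo [K], a writing of [y] modulo n^K - 1. Because [y] is
    small compared with n^K, such a cyclic writing can be turned into a genuine
    writing of [y] at no extra cost ([unwrap_digits]). Hence every conjugate has
    length at least K + D y, which is the length of (y, K) itself
    ([bs_length_ascent]). Conjugation by [t^r] divides [y] by [n^r], so the cursor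
    must go below its starting point, and this costs two more letters
    ([conj_t_ascent_length]).

    For the lower density bound, a geodesic of [h] is a digit sequence with an
    excursion of the cursor below 0 and one above the final position, both of
    which are traversed twice. Storing the lengths of the two excursions in unary
    as gaps in front of the digits gives an integer ([code]) from which [h] can be
    read off, and whose [long_ascents] element of length |h| + 13 exists because
    the letters saved on the excursions pay for the gaps ([encode]). So the sphere
    of radius [N] injects, up to inversion, into the long ascents of length
    N + 13, and spheres grow at most by a factor 4 per step. For the upper bound,
    long ascents and their inverses have the same lengths and are disjoint, since
    their second coordinates have opposite signs. *)

(** * Digit expansions of integers in base n *)

Section Digits.
Variable n : nat.
Local Notation b := (n%:Z).
Implicit Types (m j k : nat) (f : nat -> int) (d x : int).

Lemma base_expE k : b ^+ k = (n ^ k)%:Z.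
Proof. by rewrite -[RHS]natz natrX natz. Qed.

Definition digit_val m f : int := \sum_(i < m) f i * b ^+ i.
Definition digit_cost m f : nat := (\sum_(i < m) `|f i|)%N.
Definition add_digit j d f : nat -> int := fun i => if i == j then f i + d else f i.

Lemma digit_valS m f : digit_val m.+1 f = digit_val m f + f m * b ^+ m.
Proof. by rewrite /digit_val big_ord_recr. Qed.

Lemma digit_costS m f : digit_cost m.+1 f = (digit_cost m f + `|f m|)%N.
Proof. by rewrite /digit_cost big_ord_recr. Qed.

Lemma digit_val_add_digit m j d f : (j < m)%N ->
  digit_val m (add_digit j d f) = digit_val m f + d * b ^+ j.
Proof.
move=> jm; rewrite /digit_val (bigD1 (Ordinal jm)) //= [in RHS](bigD1 (Ordinal jm)) //=.
rewrite /add_digit eqxx mulrDl -!addrA; congr (_ + _); rewrite addrC; congr (_ + _).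
by apply: eq_bigr => i /negPf; rewrite -val_eqE /= => ->.
Qed.

Lemma digit_cost_add_digit m j d f : (j < m)%N ->
  (digit_cost m (add_digit j d f) + `|f j|)%N = (digit_cost m f + `|(f j + d)%R|)%N.
Proof.
move=> jm; rewrite /digit_cost (bigD1 (Ordinal jm)) //= [in RHS](bigD1 (Ordinal jm)) //=.
rewrite /add_digit eqxx.
have -> : (\sum_(i < m | i != Ordinal jm) `|(if val i == j then f i + d else f i)%R|
  = \sum_(i < m | i != Ordinal jm) `|f i|)%N.
  by apply: eq_bigr => i /negPf; rewrite -val_eqE /= => ->.
by rewrite addnC addnA [in RHS]addnAC.
Qed.

Lemma digit_cost_add_digit_le m j d f : (j < m)%N ->
  (digit_cost m (add_digit j d f) <= digit_cost m f + `|d|)%N.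
Proof. by move=> /(@digit_cost_add_digit _ _ d f); lia. Qed.

Lemma digit_val_bound m f (B : nat) : (0 < n)%N ->
  (forall i, (i < m)%N -> (`|f i| <= B * n.-1)%N) ->
  (`|digit_val m f| <= B * (n ^ m).-1)%N.
Proof.
move=> n0; elim: m => [|m IH] hf; first by rewrite /digit_val big_ord0.
rewrite digit_valS.
have h1 := IH (fun i h => hf i (leqW h)).
have h2 := hf m (leqnn _).
have -> : (B * (n ^ m.+1).-1 = B * (n ^ m).-1 + B * n.-1 * n ^ m)%N.
  have := expn_gt0 n m; rewrite n0 expnS => /=.
  case: n n0 => // n' _ /=; case: (n'.+1 ^ m)%N => //= e _; nia.
have : (`|(f m * b ^+ m)%R| <= B * n.-1 * n ^ m)%N.
  by rewrite abszM abszX absz_nat leq_mul2r h2 orbT.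
lia.
Qed.

Definition cong K x y := exists q : int, x = y + q * (b ^+ K - 1).

Lemma cong_trans K x y z : cong K x y -> cong K y z -> cong K x z.
Proof. by move=> [p ->] [q ->]; exists (p + q); ring. Qed.

Lemma cong_sym K x y : cong K x y -> cong K y x.
Proof. by move=> [p ->]; exists (- p); ring. Qed.

Lemma congD K x y z t : cong K x y -> cong K z t -> cong K (x + z) (y + t).
Proof. by move=> [p ->] [q ->]; exists (p + q); ring. Qed.

Lemma congM K x y z : cong K x y -> cong K (z * x) (z * y).
Proof. by move=> [p ->]; exists (z * p); ring. Qed.

Lemma cong_expM K k x : cong K (x * b ^+ (K * k)) x.
Proof.
elim: k => [|k [q IH]]; first by exists 0; rewrite muln0; ring.
exists (q * b ^+ K + x).
by rewrite mulnS exprD mulrCA IH; ring.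
Qed.

Lemma cong_expmod K e : cong K (b ^+ e) (b ^+ (e %% K)).
Proof.
rewrite {1}(divn_eq e K) mulnC exprD mulrC; exact: cong_expM.
Qed.

(** Modulo n^K - 1 the powers of [n] depend only on the exponent modulo [K], so
    all digits can be moved into a window of length [K]. *)
Lemma fold_digits K m f : (0 < K)%N -> exists g,
  cong K (digit_val K g) (digit_val m f) /\ (digit_cost K g <= digit_cost m f)%N.
Proof.
move=> K0; elim: m => [|m [g [hc hg]]].
  exists (fun _ => 0); split.
    by exists 0; rewrite /digit_val big_ord0 big1 ?mul0r// => i _; rewrite mul0r.
  by rewrite /digit_cost big1.
have lt := ltn_pmod m K0.
exists (add_digit (m %% K) (f m) g); split.
  rewrite digit_val_add_digit // digit_valS; apply: congD => //; apply: congM.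
  exact/cong_sym/cong_expmod.
rewrite digit_costS; have := digit_cost_add_digit_le (f m) g lt; lia.
Qed.

(** Cyclic carries: exchanging [n] units at a position for one unit at the next
    (cyclically) lowers the cost, so a cheapest cyclic writing has digits at most
    n - 1 in absolute value. *)
Lemma reduce_digits K f : (1 < n)%N -> (0 < K)%N -> exists g,
  [/\ cong K (digit_val K g) (digit_val K f), (digit_cost K g <= digit_cost K f)%N
    & forall i, (i < K)%N -> (`|g i| <= n.-1)%N].
Proof.
move=> n1 K0; have [c] := ubnP (digit_cost K f); elim: c f => // c IH f hc.
case: (boolP [forall i : 'I_K, (`|f i| <= n.-1)%N]) => [/forallP h|].
  exists f; split => //; first by exists 0; ring.
  by move=> i iK; apply: (h (Ordinal iK)).
rewrite negb_forall => /existsP[[i iK] /=]; rewrite -ltnNge => hi.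
(* The carry out of position i has the sign of the digit. *)
pose s : int := if 0 <= f i then 1 else -1.
have lt := ltn_pmod i.+1 K0.
pose f1 := add_digit i (- (s * b)) f.
pose f2 := add_digit (i.+1 %% K) s f1.
have e1 := digit_cost_add_digit (- (s * b)) f iK; rewrite -/f1 in e1.
have e2 := digit_cost_add_digit_le s f1 lt; rewrite -/f2 in e2.
have lt2 : (digit_cost K f2 < digit_cost K f)%N.
  by move: e1 e2; rewrite /s; clearbody f1 f2; case: ifP => hs; lia.
have [|g [gc gle gb]] := IH f2; first lia.
exists g; split => //; last lia.
apply: cong_trans gc _; rewrite /f2 /f1 !digit_val_add_digit //.
have [q ->] := cong_sym (cong_expmod K i.+1).
by exists (s * q); rewrite exprS; ring.
Qed.

(** A value close to n^K forces the top digit to be n - 1. Trading it for -1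
    there and an extra 1 at position 0 subtracts n^K - 1, and changes the cost by
    at most 3 - n, which is where n >= 3 enters. *)
Lemma unwrap_pos K f y : (2 < n)%N -> (0 < K)%N ->
  (forall i, (i < K)%N -> (`|f i| <= n.-1)%N) -> (`|y| < n ^ K.-1)%N ->
  digit_val K f = y + (b ^+ K - 1) ->
  exists g, digit_val K g = y /\ (digit_cost K g <= digit_cost K f)%N.
Proof.
case: K => // K n2 _ fb; rewrite /= => yb e.
have low : (`|digit_val K f| <= (n ^ K).-1)%N.
  rewrite -[X in (_ <= X)%N]mul1n; apply: digit_val_bound; first lia.
  by move=> i iK; rewrite mul1n fb // ltnS ltnW.
have top := fb K (leqnn _).
have topE : f K = n.-1%:Z.
  move: e; rewrite digit_valS exprS base_expE => e.
  have n0 : (0 < n ^ K)%N by rewrite expn_gt0; case: n n2.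
  apply: contraTeq isT => ne; exfalso.
  have h : f K <= n%:Z - 2 by lia.
  have : f K * (n ^ K)%:Z <= (n%:Z - 2) * (n ^ K)%:Z by apply: ler_wpM2r.
  move: e.
  set A := (n ^ K)%N in yb low n0 *; set F := f K; set D := digit_val K f in low *.
  rewrite mulrBl => e h1.
  have : n%:Z * A%:Z + y - 1 - D <= n%:Z * A%:Z - 2 * A%:Z by lia.
  lia.
exists (add_digit 0 1 (add_digit K (- b) f)); split.
  by rewrite !digit_val_add_digit // e exprS; ring.
have h1 := digit_cost_add_digit_le 1 (add_digit K (- b) f) (ltn0Sn K).
have h2 := digit_cost_add_digit (- b) f (ltnSn K).
rewrite topE in h2; lia.
Qed.

Lemma digit_valN m f : digit_val m (fun i => - f i) = - digit_val m f.
Proof. by rewrite /digit_val -sumrN; apply: eq_bigr => i _; rewrite mulNr. Qed.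

Lemma digit_costN m f : digit_cost m (fun i => - f i) = digit_cost m f.
Proof. by apply: eq_bigr => i _; rewrite abszN. Qed.

(** Cyclic writings of a small integer are no cheaper than genuine ones. With
    reduced digits the value lies within n^K - 1 of zero, so it can differ from
    [y] by at most one multiple of n^K - 1, and that one is removed by
    [unwrap_pos] or its mirror image. *)
Lemma unwrap_digits K m f y : (2 < n)%N -> (0 < K)%N -> (`|y| < n ^ K.-1)%N ->
  cong K (digit_val m f) y -> exists g, digit_val K g = y /\ (digit_cost K g <= digit_cost m f)%N.
Proof.
move=> n2 K0 yb fy.
have [g [gf gc]] := fold_digits m f K0.
have [h [hg hc hb]] := reduce_digits g (ltnW n2) K0.
have [q e] := cong_trans hg (cong_trans gf fy).
have {gc}hc : (digit_cost K h <= digit_cost m f)%N by lia.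
suff [k [kv kc]] : exists k : nat -> int, digit_val K k = y /\ (digit_cost K k <= digit_cost K h)%N.
  by exists k; split => //; lia.
have vb : (`|digit_val K h| <= (n ^ K).-1)%N.
  rewrite -[X in (_ <= X)%N]mul1n; apply: digit_val_bound; first lia.
  by move=> i iK; rewrite mul1n hb.
have lt : (2 * n ^ K.-1 < n ^ K)%N.
  by case: (K) K0 => // K' _; rewrite expnS ltn_pmul2r // expn_gt0; case: (n) n2.
have q1 : (`|q| <= 1)%N.
  rewrite leqNgt; apply/negP => q2.
  have : (2 * ((n ^ K).-1) <= `|(q * (b ^+ K - 1))%R|)%N.
    by rewrite abszM leq_mul // base_expE; lia.
  lia.
have [q0|[q0|q0]] : q = 0 \/ q = 1 \/ q = -1 by lia.
- by exists h; split => //; rewrite e q0; ring.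
- by apply: unwrap_pos => //; rewrite e q0; ring.
- have [|||k [kv kc]] := @unwrap_pos K (fun i => - h i) (- y) n2 K0.
  + by move=> i iK; rewrite abszN hb.
  + by rewrite abszN.
  + by rewrite digit_valN e q0; ring.
  exists (fun i => - k i); rewrite digit_valN kv opprK digit_costN; split => //.
  by rewrite -(digit_costN K h).
Qed.

Definition shift_digits f : nat -> int := fun i => if i is i'.+1 then f i' else 0.

Lemma digit_val_shift m f : digit_val m.+1 (shift_digits f) = b * digit_val m f.
Proof.
rewrite /digit_val big_ord_recl mul0r add0r mulr_sumr; apply: eq_bigr => i _ /=.
by rewrite exprS mulrCA.
Qed.

Lemma digit_cost_shift m f : digit_cost m.+1 (shift_digits f) = digit_cost m f.
Proof. by rewrite /digit_cost big_ord_recl. Qed.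

Definition trunc_digits m f : nat -> int := fun i => if (i < m)%N then f i else 0.

Lemma digit_val_trunc k m f : digit_val (m + k) (trunc_digits m f) = digit_val m f.
Proof.
elim: k => [|k IH].
  by rewrite addn0; apply: eq_bigr => i _; rewrite /trunc_digits ltn_ord.
by rewrite addnS digit_valS IH /trunc_digits ltnNge leq_addr mul0r addr0.
Qed.

Lemma digit_cost_trunc k m f : digit_cost (m + k) (trunc_digits m f) = digit_cost m f.
Proof.
elim: k => [|k IH].
  by rewrite addn0; apply: eq_bigr => i _; rewrite /trunc_digits ltn_ord.
by rewrite addnS digit_costS IH /trunc_digits ltnNge leq_addr addn0.
Qed.

(** A digit above 3(n - 1) >= 2n - 1 can give up 2n units for a carry of 2, which
    saves at least 2n - 2 > 2. This pays for the two extra steps of a cursor when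
    the window grows by one position; they account for the term [2 * k]. *)
Lemma small_digits m f : (2 < n)%N -> exists k (g : nat -> int),
  [/\ digit_val (m + k) g = digit_val m f, (digit_cost (m + k) g + 2 * k <= digit_cost m f)%N
    & forall i, (i < m + k)%N -> (`|g i| <= 3 * n.-1)%N].
Proof.
move=> n2; have [c] := ubnP (digit_cost m f); elim: c m f => // c IH m f hc.
case: (boolP [forall i : 'I_m, (`|f i| <= 3 * n.-1)%N]) => [/forallP h|].
  exists 0%N, f; rewrite !addn0; split => //.
  by move=> i iK; apply: (h (Ordinal iK)).
rewrite negb_forall => /existsP[[i im] /=]; rewrite -ltnNge => hi.
(* Position m is free after truncation, so it can receive the carry. *)
pose s : int := if 0 <= f i then 2 else -2.
pose f0 := trunc_digits m f.
pose f1 := add_digit i (- (s * b)) f0.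
pose f2 := add_digit i.+1 s f1.
have im1 : (i < m + 1)%N by rewrite addn1 ltnW.
have im2 : (i.+1 < m + 1)%N by rewrite addn1.
have e1 := digit_cost_add_digit (- (s * b)) f0 im1; rewrite -/f1 in e1.
have e2 := digit_cost_add_digit_le s f1 im2; rewrite -/f2 in e2.
have f0i : f0 i = f i by rewrite /f0 /trunc_digits im.
have e0 := digit_cost_trunc 1 m f; rewrite -/f0 in e0; rewrite f0i in e1.
have lt2 : (digit_cost (m + 1) f2 + 2 <= digit_cost m f)%N.
  by move: e1 e2; rewrite /s; clearbody f1 f2 f0; case: ifP => hs; lia.
have [|k [g [gv gc gb]]] := IH (m + 1)%N f2; first lia.
exists k.+1, g; have -> : (m + k.+1 = m + 1 + k)%N by lia.
split => //; last lia.
rewrite gv /f2 /f1 !digit_val_add_digit // /f0 digit_val_trunc exprS; ring.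
Qed.

Definition representable y c := exists m f, digit_val m f = y /\ (digit_cost m f <= c)%N.

Lemma representable_shift k y c :
  representable y c -> representable (b ^+ k * y) c.
Proof.
elim: k => [|k IH]; first by rewrite mul1r.
move=> /IH[m [f [e h]]]; exists m.+1, (shift_digits f).
by rewrite digit_val_shift digit_cost_shift e exprS mulrA.
Qed.

Lemma representable_add j d y c :
  representable y c -> representable (y + d * b ^+ j) (c + `|d|).
Proof.
move=> [m [f [e h]]].
have jm : (j < m + j.+1)%N by lia.
exists (m + j.+1)%N, (add_digit j d (trunc_digits m f)).
rewrite digit_val_add_digit // digit_val_trunc e; split => //.
have := digit_cost_add_digit_le d (trunc_digits m f) jm; rewrite digit_cost_trunc; lia.
Qed.

Lemma representable_ex y : exists c, `[< representable y c >].
Proof.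
exists `|y|%N; apply/asboolP; exists 1%N, (fun _ => y).
by rewrite /digit_val /digit_cost !big_ord1 mulr1.
Qed.

Definition min_cost y : nat := ex_minn (representable_ex y).

Lemma min_costP y : representable y (min_cost y).
Proof. by rewrite /min_cost; case: ex_minnP => c /asboolP. Qed.

Lemma min_cost_min y c : representable y c -> (min_cost y <= c)%N.
Proof. by rewrite /min_cost; case: ex_minnP => k _ h /asboolP; exact: h. Qed.

End Digits.

(** * Geodesics and digits: upper bounds for the word length *)

Section Group.
Variable n : nat.
Local Notation b := (n%:Z).
Local Notation a := (bs_class n [:: let_a]).
Local Notation t := (bs_class n [:: let_t]).
Implicit Types (g h p : BS n) (w : word) (z : int).

Definition powa z : BS n :=
  match z with Posz m => (a ^+ m)%g | Negz m => ((a ^+ m.+1)^-1)%g end.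

Lemma powaS z : powa (z + 1) = (powa z * a)%g.
Proof.
case: z => m.
  have -> : Posz m + 1 = Posz m.+1 by lia.
  by rewrite /= expgSr.
case: m => [|m]; first by rewrite /= mulVg.
have -> : Negz m.+1 + 1 = Negz m by rewrite !NegzE; lia.
by rewrite /= [in RHS]expgS invgM mulgVK.
Qed.

Lemma powaB1 z : powa (z - 1) = (powa z * a^-1)%g.
Proof. by rewrite -{2}(subrK 1 z) powaS mulgK. Qed.

Lemma powaD y z : powa (y + z) = (powa y * powa z)%g.
Proof.
elim/int_rec: z => [|m IH|m IH]; first by rewrite addr0 /= mulg1.
- by rewrite -addn1 PoszD addrA !powaS IH mulgA.
- by rewrite -addn1 PoszD opprD addrA !powaB1 IH mulgA.
Qed.

Lemma powaN z : powa (- z) = ((powa z)^-1)%g.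
Proof. by apply: (@mulgI _ (powa z)); rewrite -powaD subrr mulgV. Qed.

(** The defining relation, extended to all powers of [a]. *)
Lemma t_powa z : (t * powa z)%g = (powa (b * z) * t)%g.
Proof.
have base : (t * a)%g = (powa b * t)%g.
  by rewrite /= -bs_relation mulgVK.
have step y : (t * powa y)%g = (powa (b * y) * t)%g ->
    (t * powa (y + 1))%g = (powa (b * (y + 1)) * t)%g.
  by move=> h; rewrite powaS mulgA h -mulgA base mulgA -powaD mulrDr mulr1.
have stepN y : (t * powa y)%g = (powa (b * y) * t)%g ->
    (t * powa (y - 1))%g = (powa (b * (y - 1)) * t)%g.
  move=> h; rewrite powaB1 mulgA h mulrBr mulr1 powaD powaN -!mulgA; congr (_ * _)%g.
  by apply: (@mulgI _ (powa b)); rewrite mulVKg mulgA -base mulgK.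
elim/int_rec: z => [|m IH|m IH]; first by rewrite mulr0 /= mulg1 mul1g.
- by rewrite -addn1 PoszD; exact: step.
- by rewrite -addn1 PoszD opprD; exact: stepN.
Qed.

Lemma tX_powa e z : (t ^+ e * powa z)%g = (powa (z * b ^+ e) * t ^+ e)%g.
Proof.
elim: e => [|e IH]; first by rewrite mulr1 mul1g mulg1.
by rewrite expgS -mulgA IH mulgA t_powa -mulgA exprS; congr (powa _ * _)%g; ring.
Qed.

Lemma bs_length_class w : (bs_length (bs_class n w) <= size w)%N.
Proof.
rewrite /bs_length; case: ex_minnP => m _ h; apply: h.
by apply/asboolP; exists w.
Qed.

Lemma bs_length_word g : exists2 w, size w = bs_length g & bs_class n w = g.
Proof. by rewrite /bs_length; case: ex_minnP => m /asboolP. Qed.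

Lemma bs_lengthM g h : (bs_length (g * h)%g <= bs_length g + bs_length h)%N.
Proof.
have [u <- <-] := bs_length_word g; have [v <- <-] := bs_length_word h.
by rewrite bs_mulE -size_cat; exact: bs_length_class.
Qed.

Lemma bs_lengthV_le g : (bs_length g^-1%g <= bs_length g)%N.
Proof.
have [u <- <-] := bs_length_word g; rewrite bs_invE.
by apply: leq_trans (bs_length_class _) _; rewrite /winv size_rev size_map.
Qed.

Lemma bs_lengthV g : bs_length g^-1%g = bs_length g.
Proof. by apply/eqP; rewrite eqn_leq bs_lengthV_le -{1}(invgK g) bs_lengthV_le. Qed.

Lemma bs_length1 : bs_length (1%g : BS n) = 0%N.
Proof.
have -> : 1%g = bs_class n [::] by [].
by apply/eqP; rewrite -leqn0; exact: bs_length_class.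
Qed.

Lemma bs_lengthX g e : (bs_length (g ^+ e)%g <= e * bs_length g)%N.
Proof.
elim: e => [|e IH]; first by rewrite expg0 bs_length1.
by rewrite expgS mulSn; apply: leq_trans (bs_lengthM _ _) _; rewrite leq_add2l.
Qed.

Lemma bs_length_powa z : (bs_length (powa z) <= `|z|)%N.
Proof.
have la : (bs_length a <= 1)%N := bs_length_class _.
have aX m : (bs_length (a ^+ m)%g <= m)%N.
  by apply: leq_trans (bs_lengthX _ _) _; rewrite -{2}(muln1 m) leq_mul2l la orbT.
by case: z => m; rewrite /powa ?bs_lengthV; apply: aX.
Qed.

(** Horner's scheme, read as the word a^(f 0) t a^(f 1) t ... a^(f (K-1)) t. *)
Lemma bs_length_digits K f :
  (bs_length (powa (digit_val n K f) * t ^+ K)%g <= K + digit_cost K f)%N.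
Proof.
elim: K => [|K IH].
  by rewrite /digit_val big_ord0 mulg1 bs_length1.
have -> : (powa (digit_val n K.+1 f) * t ^+ K.+1 =
           powa (digit_val n K f) * t ^+ K * powa (f K) * t)%g.
  by rewrite digit_valS powaD expgSr -!mulgA; congr (_ * _)%g; rewrite !mulgA tX_powa.
apply: leq_trans (bs_lengthM _ _) _; have := bs_length_class [:: let_t].
have := bs_lengthM (powa (digit_val n K f) * t ^+ K)%g (powa (f K)).
have := bs_length_powa (f K); rewrite digit_costS /=; lia.
Qed.

End Group.

(** * Coordinates in Z[1/n] x| Z and normal forms of words *)

Section Coordinates.
Variable n : nat.
Hypothesis n2 : (2 < n)%N.
Local Notation b := (n%:Z).
Local Notation q := (n%:R : rat).
Local Notation a := (bs_class n [:: let_a]).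
Local Notation t := (bs_class n [:: let_t]).
Implicit Types (g h p : BS n) (w : word) (x : letter) (y z : int).

(** The coordinates of a letter: [a] is (1, 0) and [t] is (0, 1), with product
    (x, k)(y, l) = (x + n^k y, k + l). *)
Definition letter_x x : rat := if x.1 then 0 else if x.2 then -1 else 1.
Definition letter_k x : int := if x.1 then if x.2 then -1 else 1 else 0.

Fixpoint word_k w : int := if w is x :: w' then letter_k x + word_k w' else 0.
Fixpoint word_x w : rat :=
  if w is x :: w' then letter_x x + q ^ letter_k x * word_x w' else 0.

Let q0 : q != 0.
Proof. by rewrite pnatr_eq0; case: (n) n2. Qed.

Lemma word_k_cat u v : word_k (u ++ v) = word_k u + word_k v.
Proof. by elim: u => [|x u IH] /=; rewrite ?add0r // IH addrA. Qed.

Lemma word_x_cat u v : word_x (u ++ v) = word_x u + q ^ word_k u * word_x v.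
Proof.
elim: u => [|x u IH] /=; first by rewrite expr0z mul1r add0r.
by rewrite IH mulrDr expfzDr // addrA mulrA.
Qed.

Lemma word_a m : word_k (nseq m let_a) = 0 /\ word_x (nseq m let_a) = m%:R.
Proof.
elim: m => [|m [IHk IHx]] //=; rewrite IHk IHx /letter_k /letter_x /=.
by split; rewrite ?addr0 // expr0z mul1r -natr1 addrC.
Qed.

Lemma word_coordP w1 w2 : bs_eqv n w1 w2 ->
  word_k w1 = word_k w2 /\ word_x w1 = word_x w2.
Proof.
elim=> {w1 w2} [w|w1 w2 _ [-> ->]|w2 w1 w3 _ [-> ->] _ [-> ->]|u v x|u v] //.
  rewrite !(word_k_cat, word_x_cat) /=.
  have -> : letter_k (linv x) = - letter_k x.
    by case: x => [[] []]; rewrite /letter_k //= opprK.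
  have -> : letter_x (linv x) = - (q ^ (- letter_k x) * letter_x x).
    by case: x => [[] []]; rewrite /letter_k /letter_x /= ?mulr0 ?oppr0 // expr0z; ring.
  rewrite addr0 subrr add0r; split=> //; congr (_ + _ * _).
  rewrite mulrDr mulrN !mulrA -expfzDr // subrr expr0z mul1r.
  by rewrite addrA subrr add0r mul1r.
have [ak ax] := word_a n.
rewrite !(word_k_cat, word_x_cat) ak ax /= /letter_k /letter_x /=.
rewrite !(expr0z, expr1z, exprN1); split; first by ring.
by rewrite !(add0r, addr0, mulr0, mul1r) mulr1.
Qed.

Definition coord_k g : int := word_k (repr g).
Definition coord_x g : rat := word_x (repr g).

Lemma coord_k_class w : coord_k (bs_class n w) = word_k w.
Proof.
by apply: (proj1 (@word_coordP _ _ _)); apply/bs_classP; rewrite bs_classK.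
Qed.

Lemma coord_x_class w : coord_x (bs_class n w) = word_x w.
Proof.
by apply: (proj2 (@word_coordP _ _ _)); apply/bs_classP; rewrite bs_classK.
Qed.

Lemma coord_kM g h : coord_k (g * h)%g = coord_k g + coord_k h.
Proof.
by rewrite -(bs_classK g) -(bs_classK h) bs_mulE !coord_k_class word_k_cat.
Qed.

Lemma coord_xM g h : coord_x (g * h)%g = coord_x g + q ^ coord_k g * coord_x h.
Proof.
rewrite -(bs_classK g) -(bs_classK h) bs_mulE.
by rewrite !coord_x_class coord_k_class word_x_cat.
Qed.

Lemma coord1 : coord_k 1%g = 0 /\ coord_x 1%g = 0.
Proof.
have -> : 1%g = bs_class n [::] by [].
by rewrite coord_k_class coord_x_class.
Qed.

Lemma coord_kV g : coord_k g^-1%g = - coord_k g.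
Proof. by apply: (addrI (coord_k g)); rewrite -coord_kM mulgV coord1.1 subrr. Qed.

Lemma coord_xV g : coord_x g^-1%g = - (q ^ (- coord_k g) * coord_x g).
Proof.
have := coord_xM g^-1%g g; rewrite mulVg coord1.2 coord_kV => /esym/eqP.
by rewrite addr_eq0 => /eqP.
Qed.

Lemma coord_tX e : coord_k (t ^+ e)%g = e /\ coord_x (t ^+ e)%g = 0.
Proof.
elim: e => [|e [IHk IHx]]; first exact: coord1.
rewrite expgSr coord_kM coord_xM IHk IHx coord_k_class coord_x_class /=.
by rewrite /letter_k /letter_x /= !(mulr0, addr0); split => //; lia.
Qed.

Lemma coord_powa z : coord_k (powa n z) = 0 /\ coord_x (powa n z) = z%:~R.
Proof.
have aX m : coord_k (a ^+ m)%g = 0 /\ coord_x (a ^+ m)%g = m%:R.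
  elim: m => [|m [IHk IHx]]; first exact: coord1.
  rewrite expgSr coord_kM coord_xM IHk IHx coord_k_class coord_x_class /=.
  by rewrite /letter_k /letter_x /= !(mulr0, addr0) expr0z mul1r natr1.
case: z => m; rewrite /powa; first exact: aX.
rewrite coord_kV coord_xV (aX m.+1).1 (aX m.+1).2 oppr0 expr0z mul1r.
by rewrite NegzE mulrNz.
Qed.

Definition normal_form u y e : BS n := ((t ^+ u)^-1 * powa n y * t ^+ e)%g.

Lemma coord_normal_form u y e : coord_k (normal_form u y e) = e%:Z - u%:Z
  /\ coord_x (normal_form u y e) = q ^- u * y%:~R.
Proof.
rewrite /normal_form !(coord_kM, coord_xM, coord_kV, coord_xV).
rewrite !(coord_tX _).1 !(coord_tX _).2 !(coord_powa _).1 !(coord_powa _).2.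
by rewrite !(mulr0, oppr0, addr0, add0r) -exprnN; split => //; rewrite addrC.
Qed.

(** A word moves a cursor, by its letters [t], over an interval from [- u] to [v]
    that contains 0 and the final position [e - u]; its letters [a] add or subtract
    units at the cursor. Visiting the whole interval takes at least
    2(u + v) - |e - u| steps. Digit [i] of [f] sits at position [i - u]. *)
Lemma normal_formP w : exists u v e f,
  [/\ bs_class n w = normal_form u (digit_val n (u + v).+1 f) e, (e <= u + v)%N
    & (digit_cost (u + v).+1 f + 2 * (u + v) <= size w + `|e%:Z - u%:Z|)%N].
Proof.
elim/last_ind: w => [|w x [u [v [e [f [E le_e le_c]]]]]].
  exists 0%N, 0%N, 0%N, (fun _ => 0); split => //.
    by rewrite /normal_form /digit_val big_ord1 mul0r mulg1 invg1 mul1g.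
  by rewrite /digit_cost big_ord1.
have {}E : bs_class n (rcons w x) =
    (normal_form u (digit_val n (u + v).+1 f) e * bs_class n [:: x])%g.
  by rewrite -cats1 -bs_mulE E.
have at_a z : `|z|%N = 1%N -> bs_class n [:: x] = powa n z -> exists u v e f,
  [/\ bs_class n (rcons w x) = normal_form u (digit_val n (u + v).+1 f) e, (e <= u + v)%N
    & (digit_cost (u + v).+1 f + 2 * (u + v) <= size (rcons w x) + `|e%:Z - u%:Z|)%N].
  move=> z1 xE; exists u, v, e, (add_digit e z f); split => //.
    rewrite E xE digit_val_add_digit // /normal_form powaD -!mulgA.
    by congr (_ * (_ * _))%g; rewrite tX_powa.
  have := @digit_cost_add_digit_le (u + v).+1 e z f le_e; rewrite size_rcons; lia.
case: x at_a E => [[] []] at_a E.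
- case: e le_e le_c E => [|e] le_e le_c E.
    (* The cursor leaves the window at the bottom: position - u - 1 becomes digit 0. *)
    exists u.+1, v, 0%N, (shift_digits f); split => //.
      rewrite E -/(linv let_t) /normal_form addSn digit_val_shift !mulg1.
      have -> : bs_class n [:: (true, true)] = (t^-1)%g by rewrite bs_invE.
      rewrite expgS invgM -!mulgA; congr (_ * _)%g.
      by apply: (@mulgI _ t); rewrite mulVKg mulgA t_powa mulgK.
    rewrite addSn digit_cost_shift size_rcons; lia.
  exists u, v, e, f; split; [|lia|rewrite size_rcons; lia].
  rewrite E /normal_form -!mulgA expgSr; congr (_ * (_ * _))%g.
  have -> : bs_class n [:: (true, true)] = (t^-1)%g by rewrite bs_invE.
  by rewrite mulgK.
- have Et : bs_class n (rcons w (true, false)) =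
     normal_form u (digit_val n (u + v).+1 f) e.+1.
    by rewrite E /normal_form expgSr !mulgA.
  case: (ltnP e (u + v)) => h.
    by exists u, v, e.+1, f; split => //; rewrite size_rcons; lia.
  (* The cursor leaves the window at the top. *)
  exists u, v.+1, e.+1, (trunc_digits (u + v).+1 f).
  have -> : (u + v.+1).+1 = ((u + v).+1 + 1)%N by lia.
  rewrite digit_val_trunc digit_cost_trunc size_rcons; split=> //; lia.
- apply: (at_a (-1)) => //.
  by rewrite [RHS]/= bs_invE.
- exact: (at_a 1).
Qed.

Lemma normal_form_geodesic g : exists u v e f,
  [/\ g = normal_form u (digit_val n (u + v).+1 f) e, (e <= u + v)%N
    & (digit_cost (u + v).+1 f + 2 * (u + v) <= bs_length g + `|e%:Z - u%:Z|)%N].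
Proof. have [w <- <-] := bs_length_word g; exact: normal_formP. Qed.

End Coordinates.

(** * Conjugates of ascending elements *)

Section Conjugation.
Variable n : nat.
Hypothesis n2 : (2 < n)%N.
Local Notation b := (n%:Z).
Local Notation q := (n%:R : rat).
Local Notation t := (bs_class n [:: let_t]).
Implicit Types (g h p : BS n) (y z : int).

Let q0 : q != 0.
Proof. by rewrite pnatr_eq0; case: (n) n2. Qed.

Lemma coord_conj p g : coord_k (p^-1 * g * p)%g = coord_k g /\
  coord_x (p^-1 * g * p)%g =
    q ^ (- coord_k p) * (coord_x g + (q ^ coord_k g - 1) * coord_x p).
Proof.
rewrite !(coord_kM n2, coord_xM n2, coord_kV n2, coord_xV n2); split; first by ring.
by rewrite expfzDr //; ring.
Qed.

Definition ascent y K : BS n := (powa n y * t ^+ K)%g.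

Lemma coord_ascent y K : coord_k (ascent y K) = K /\ coord_x (ascent y K) = y%:~R.
Proof.
rewrite /ascent (coord_kM n2) (coord_xM n2) !(coord_tX n2 _).1 !(coord_tX n2 _).2.
by rewrite !(coord_powa n2 _).1 !(coord_powa n2 _).2 mulr0 addr0 add0r.
Qed.

(** Multiplication by [n] rotates cyclic writings, so a writing that agrees with
    [y] only up to powers of [n] modulo n^K - 1 costs at least as much as [y]. *)
Lemma rotate_digits K e s c m f y : (0 < K)%N -> (`|y| < n ^ K.-1)%N ->
  b ^+ e * digit_val n m f = b ^+ s * y + c * (b ^+ K - 1) ->
  (min_cost n y <= digit_cost m f)%N.
Proof.
move=> K0 yb E.
have fr : representable n (digit_val n m f) (digit_cost m f) by exists m, f.
have [m' [f' [fv fc]]] := representable_shift (K.-1 * s + e) fr.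
have fy : cong n K (digit_val n m' f') y.
  rewrite fv exprD -mulrA E.
  apply: cong_trans (cong_expM n K s y).
  (* The shift by (K - 1) s completes the factor n^s to a power of n^K. *)
  have -> : b ^+ (K * s) = b ^+ (K.-1 * s) * b ^+ s.
    by rewrite -exprD -mulSnr prednK.
  by exists (b ^+ (K.-1 * s) * c); ring.
have [g [gv gc]] := unwrap_digits n2 K0 yb fy.
by apply: leq_trans fc; apply: min_cost_min; exists K, g.
Qed.

(** The geodesic of a conjugate travels from 0 to [K] and at least twice over
    the [u] positions below 0. The conjugating element contributes a multiple of n^K - 1
    and a power of [n] to the first coordinate, both invisible to
    [rotate_digits]. *)
Lemma conj_ascent_length y K p : (0 < K)%N -> (`|y| < n ^ K.-1)%N ->
  exists u z, coord_x (p^-1 * ascent y K * p)%g = q ^- u * z%:~R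
    /\ (K + min_cost n y + 2 * u <= bs_length (p^-1 * ascent y K * p)%g)%N.
Proof.
move=> K0 yb; set c := (p^-1 * _ * _)%g.
have ck : coord_k c = K.
  by rewrite (coord_conj p _).1 (coord_ascent y K).1.
have [u [v [e [f [cE le_e le_c]]]]] := normal_form_geodesic n2 c.
have [up [vp [ep [fp [pE _ _]]]]] := normal_form_geodesic n2 p.
move: (digit_val n _ fp) pE => yp pE.
have [ck' cx] := coord_normal_form n2 u (digit_val n (u + v).+1 f) e.
rewrite -cE ck in ck'; rewrite -cE in cx.
have [pk px] := coord_normal_form n2 up yp ep; rewrite -pE in pk px.
exists u, (digit_val n (u + v).+1 f); split => //.
suff : (min_cost n y <= digit_cost (u + v).+1 f)%N by lia.
apply: (@rotate_digits K ep (u + up) (b ^+ u * yp)) => //.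
have : coord_x c = q ^+ up / q ^+ ep * (y%:~R + (q ^+ K - 1) * (q ^- up * yp%:~R)).
  rewrite (coord_conj p _).2 (coord_ascent y K).1 (coord_ascent y K).2 px pk.
  by rewrite opprB expfzDr // -exprnN.
rewrite cx => E.
apply: (@intr_inj rat); rewrite !(rmorphD, rmorphM, rmorphB, rmorphXn, rmorphN) /=.
rewrite -!pmulrn in E *.
have {E} : q ^+ ep * q ^+ u * (q ^- u * (digit_val n (u + v).+1 f)%:~R) =
   q ^+ ep * q ^+ u *
   (q ^+ up / q ^+ ep * (y%:~R + (q ^+ K - 1) * (q ^- up * yp%:~R))) by rewrite E.
have qe k : q ^+ k != 0 by rewrite expf_neq0.
rewrite -mulrA mulVKf // => ->.
rewrite exprD; field.
by rewrite !qe.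
Qed.

Lemma bs_length_ascent y K : (0 < K)%N -> (`|y| < n ^ K.-1)%N ->
  bs_length (ascent y K) = (K + min_cost n y)%N.
Proof.
move=> K0 yb; apply/eqP; rewrite eqn_leq; apply/andP; split.
  have [m [f [fy fc]]] := min_costP n y.
  have [|g [gy gc]] := @unwrap_digits n K m f y n2 K0 yb.
    by rewrite fy; exists 0; ring.
  have := bs_length_digits n K g; rewrite gy /ascent; lia.
have [u [z [_]]] := conj_ascent_length 1%g K0 yb.
rewrite invg1 mul1g mulg1; lia.
Qed.

(** The first coordinate of the conjugate is y / n^r. It is not an integer, so the
    number [u] of positions below 0 is positive. *)
Lemma conj_t_ascent_length y K r : (0 < K)%N -> (`|y| < n ^ K.-1)%N ->
  (0 < r)%N -> ~~ (b %| y)%Z ->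
  (bs_length (ascent y K) < bs_length ((t ^+ r)^-1 * ascent y K * t ^+ r)%g)%N.
Proof.
move=> K0 yb r0 yn; rewrite bs_length_ascent //.
have [u [z [E h]]] := conj_ascent_length (t ^+ r)%g K0 yb.
case: u E h => [|u] E h; last lia.
case/negP: yn; case: r r0 E {h} => // r _.
rewrite (coord_conj _ _).2 (coord_tX n2 _).1 (coord_tX n2 _).2 (coord_ascent y K).2.
rewrite mulr0 addr0 invr1 mul1r -exprnN => E.
apply/dvdzP; exists (z * b ^+ r); apply: (@intr_inj rat).
rewrite !rmorphM rmorphXn /= -E -!pmulrn -mulrA -exprSr mulrC mulVKf //.
by rewrite expf_neq0.
Qed.

Lemma bs_length_tX e : bs_length (t ^+ e)%g = e.
Proof.
apply/eqP; rewrite eqn_leq; apply/andP; split.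
  apply: leq_trans (bs_lengthX _ _) _; rewrite -[X in (_ <= X)%N]muln1 leq_mul2l.
  by rewrite (bs_length_class n [:: let_t]) orbT.
have [u [v [k [f [E le_k h]]]]] := normal_form_geodesic n2 (t ^+ e)%g.
have := (coord_normal_form n2 u (digit_val n (u + v).+1 f) k).1.
rewrite -E (coord_tX n2 e).1; lia.
Qed.

Variable R : realType.

(** All terms of the average are at least the length of [g], and the one of [p0]
    is larger. *)
Lemma conj_curvature_lt0 r g p0 :
  (0 < bs_length g)%N ->
  (forall p, (bs_length g <= bs_length (p^-1 * g * p)%g)%N) ->
  bs_length p0 = r -> (bs_length g < bs_length (p0^-1 * g * p0)%g)%N ->
  conj_curvature R r g < 0.
Proof.
move=> g0 hle p0r hlt; rewrite /conj_curvature.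
rewrite pmulr_llt0 ?invr_gt0 ?ltr0n // subr_lt0.
set S := fset_set (sphere r).
have p0S : p0 \in S by rewrite in_fset_set ?inE //; exact: finite_sphere.
have S0 : (0 < #|` S|)%N by rewrite cardfs_gt0; apply/fset0Pn; exists p0.
rewrite ltr_pdivlMl ?ltr0n //.
rewrite (big_fsetD1 p0) //= (cardfsD1 p0) p0S natrD mulrDl mul1r.
apply: ltr_leD; first by rewrite ltr_nat.
rewrite mulr_natl -iter_addr_0 -count_predT -big_const_seq.
by apply: ler_sum => p _; rewrite ler_nat.
Qed.

End Conjugation.

(** * Density *)

Section Density.
Variable n : nat.
Hypothesis n2 : (2 < n)%N.
Local Notation b := (n%:Z).
Local Notation t := (bs_class n [:: let_t]).
Implicit Types (g h p : BS n) (y z : int).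

Let n_gt0 : (0 < n)%N.
Proof. by case: (n) n2. Qed.

Let expn_pos k : (0 < n ^ k)%N.
Proof. by rewrite expn_gt0 n_gt0. Qed.

Definition long_ascents : set (BS n) := [set g | exists y K,
  [/\ g = ascent n y K, (0 < K)%N, (`|y| < n ^ K.-1)%N & ~~ (b %| y)%Z]]%classic.

(** In base [n], the digits of [z] preceded by [k] zeros and a final 1. The number
    [k] can be recovered when [n] does not divide [z]. *)
Definition mark k z : int := 1 + b ^+ k.+1 * z.

Lemma dvdz_mark k z : ~~ (b %| mark k z)%Z.
Proof.
apply/negP => /dvdzP[c /eqP]; rewrite /mark exprS -mulrA addrC -subr_eq0.
rewrite addrAC addr_eq0 [c * _]mulrC -mulrBr => /eqP/(congr1 absz).
by rewrite abszM abszN absz1 absz_nat => /eqP; rewrite muln_eq1; case: (n) n2 => [|[]].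
Qed.

(** The number of zeros is read off as an n-adic valuation. *)
Lemma mark_inj j k x y : ~~ (b %| x)%Z -> ~~ (b %| y)%Z ->
  mark j x = mark k y -> j = k /\ x = y.
Proof.
have b0 i : b ^+ i != 0 by rewrite expf_neq0 // eqz_nat -lt0n.
wlog jk : j k x y / (j <= k)%N.
  move=> W hx hy E; case: (leqP j k) => [/W|/ltnW/W] h; first exact: h.
  by have [-> ->] := h y x hy hx (esym E).
move=> hx _ /addrI; rewrite -(subnKC jk) -addSn exprD -mulrA => /(mulfI (b0 _)) E.
case: (k - j)%N E => [|d] E; first by rewrite addn0 E mul1r.
by case/negP: hx; rewrite E exprS -mulrA dvdz_mulr.
Qed.

Lemma mark_bound E k z : 0 < z < (n ^ E)%:Z ->
  0 < mark k z < (n ^ (E + k.+1))%:Z.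
Proof.
case/andP=> z0 zE; rewrite /mark base_expE expnD PoszM.
have p0 : (n <= n ^ k.+1)%N by rewrite expnS leq_pmulr.
move: (n ^ k.+1)%N p0 (n ^ E)%N zE => A hA B zB.
apply/andP; split; first by nia.
have : A%:Z * z <= A%:Z * (B%:Z - 1) by rewrite ler_wpM2l //; lia.
rewrite mulrBr mulr1 mulrC; lia.
Qed.

(** The outer two marks store [u] and [w]; the inner one makes the argument of the
    second mark prime to [n]. The power of [n] added to [y] stores [m] as an order of
    magnitude. *)
Definition code u w m y := mark u (mark w (mark 0 (y + b ^+ m.+2))).

Lemma code_inj u w m y u' w' m' y' :
  (`|y| < n ^ m.+1)%N -> (`|y'| < n ^ m'.+1)%N ->
  code u w m y = code u' w' m' y' -> [/\ u = u', w = w', m = m' & y = y'].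
Proof.
move=> hy hy' /mark_inj[]; try exact: dvdz_mark.
move=> -> /mark_inj[]; try exact: dvdz_mark.
move=> -> /addrI; rewrite expr1 => /mulfI E.
have {}E : y + b ^+ m.+2 = y' + b ^+ m'.+2 by apply: E; rewrite eqz_nat -lt0n.
suff mm : m = m' by move: E; rewrite mm => /addIr.
(* The added power of n dominates, so the order of magnitude determines m. *)
have sep i j x x' : (`|x| < n ^ i.+1)%N -> (`|x'| < n ^ j.+1)%N ->
    (i < j)%N -> x + b ^+ i.+2 <> x' + b ^+ j.+2.
  move=> hx hx' ij; rewrite !base_expE => {}E.
  have h1 : (n ^ i.+2 <= n ^ j.+1)%N by rewrite leq_exp2l // ltnW.
  have h2 : (3 * n ^ i.+1 <= n ^ i.+2)%N by rewrite [X in (_ <= X)%N]expnS leq_mul2r n2 orbT.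
  have h3 : (3 * n ^ j.+1 <= n ^ j.+2)%N by rewrite [X in (_ <= X)%N]expnS leq_mul2r n2 orbT.
  lia.
by case: (ltngtP m m') => // lt; [case: (sep _ _ _ _ hy hy' lt) | case: (sep _ _ _ _ hy' hy lt)].
Qed.

(** In the normal form of a geodesic, the final position [e - u] of the cursor lies
    [w] below the top of the window of [m] digits. The number 13 covers the four
    digits of the code that do not come from [h], the positions added by the marks
    and by the power of [n], and the margin in |y| < n^(K-1). *)
Lemma encode h : 0 <= coord_k h -> exists u w m y,
  [/\ h = normal_form n u y (m.-1 - w), (`|y| < n ^ m.+1)%N &
    exists g, g = ascent n (code u w m y) (bs_length h + 13 - min_cost n (code u w m y))
     /\ slice long_ascents (bs_length h + 13) g].
Proof.
move=> h0.
have [u [v [e [f [hE le_e le_c]]]]] := normal_form_geodesic n2 h.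
have [k [f1 [f1v f1c f1b]]] := small_digits (u + v).+1 f n2.
have := (coord_normal_form n2 u (digit_val n (u + v).+1 f) e).1; rewrite -hE => hk.
rewrite -f1v in hE; set m := ((u + v).+1 + k)%N in f1v f1c f1b hE.
pose w := (m.-1 - e)%N; pose y := digit_val n m f1.
have yb : (`|y| < n ^ m.+1)%N.
  have := digit_val_bound n_gt0 f1b; rewrite -/y expnS.
  have := leq_mul n2 (leqnn (n ^ m)); have := expn_pos m; lia.
exists u, w, m, y; split => //.
  by rewrite hE; congr normal_form; rewrite /w /m; lia.
have z_bound : 0 < y + b ^+ m.+2 < (n ^ m.+3)%:Z.
  rewrite base_expE.
  have h2 : (3 * n ^ m.+1 <= n ^ m.+2)%N by rewrite [X in (_ <= X)%N]expnS leq_mul2r n2 orbT.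
  have h3 : (3 * n ^ m.+2 <= n ^ m.+3)%N by rewrite [X in (_ <= X)%N]expnS leq_mul2r n2 orbT.
  lia.
have := mark_bound u (mark_bound w (mark_bound 0 z_bound)).
rewrite -/(code u w m y) => /andP[c0 cb].
have dc : (min_cost n (code u w m y) <= digit_cost m f1 + 4)%N.
  have r0 : representable n y (digit_cost m f1) by exists m, f1.
  have r1 := representable_add m.+2 1 r0; rewrite mul1r in r1.
  have mark_rep j z c : representable n z c -> representable n (mark j z) (c + 1).
    move=> r; have := representable_add 0 1 (representable_shift j.+1 r).
    by rewrite /mark mul1r expr0 addrC.
  have := mark_rep u _ _ (mark_rep w _ _ (mark_rep 0%N _ _ r1)).
  by move=> /min_cost_min; rewrite -!addnA.
set c := code u w m y in c0 cb dc *; set K := (bs_length h + 13 - min_cost n c)%N.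
(* The code costs at most 4 more than the digits of h, and the remaining letters
   of h number at least 2 (m - 1) - |e - u| = m + u + w - 1. *)
have KE : (m.+3 + 1 + w.+1 + u.+1 < K)%N by rewrite /K /w /m; rewrite /m in f1c dc; lia.
have K0 : (0 < K)%N by lia.
have cK : (`|c| < n ^ K.-1)%N.
  have : (n ^ (m.+3 + 1 + w.+1 + u.+1) <= n ^ K.-1)%N by rewrite leq_exp2l; lia.
  lia.
exists (ascent n c K); split => //; split.
  by exists c, K; split => //; exact: dvdz_mark.
rewrite /sphere /= bs_length_ascent // /K subnK //; lia.
Qed.

Lemma leq_card_fset_inj (T U : choiceType) (X : set T) (Y : set U) (F : T -> U) :
  finite_set X -> finite_set Y -> (forall x, X x -> Y (F x)) ->
  (forall x x', X x -> X x' -> F x = F x' -> x = x') ->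
  (#|` fset_set X| <= #|` fset_set Y|)%N.
Proof.
move=> fX fY XY inj.
rewrite -(size_map F); apply: uniq_leq_size.
  rewrite map_inj_in_uniq ?fset_uniq // => x x'.
  by rewrite !in_fset_set // !inE; exact: inj.
by move=> _ /mapP[x + ->]; rewrite !in_fset_set // !inE; exact: XY.
Qed.

Lemma finite_slice (A : set (BS n)) N : finite_set (slice A N).
Proof. by apply: sub_finite_set (@finite_sphere n N) => g []. Qed.

Definition upward : set (BS n) := [set h | 0 <= coord_k h]%classic.

Lemma card_upward N :
  (#|` fset_set (slice upward N)| <= #|` fset_set (slice long_ascents (N + 13))|)%N.
Proof.
have /choice[F FP] : forall h, exists g, slice upward N h ->
    exists u w m y, [/\ h = normal_form n u y (m.-1 - w), (`|y| < n ^ m.+1)%N,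
      g = ascent n (code u w m y) (N + 13 - min_cost n (code u w m y))
      & slice long_ascents (N + 13) g].
  move=> h; case: (pselect (slice upward N h)) => [[h0 hN]|]; last by exists h.
  have [u [w [m [y [hE yb [g [gE gA]]]]]]] := encode h0.
  by exists g => _; exists u, w, m, y; rewrite -hN; split.
apply: (@leq_card_fset_inj _ _ _ _ F); [exact: finite_slice..| |].
  by move=> h /FP[u [w [m [y []]]]].
move=> h h' /FP[u [w [m [y [-> yb FE _]]]]] /FP[u' [w' [m' [y' [-> yb' FE' _]]]]].
rewrite {}FE {}FE' => /(congr1 (@coord_x n)).
rewrite !(coord_ascent n2 _ _).2 => /intr_inj /code_inj.
by move=> /(_ yb yb')[-> -> -> ->].
Qed.

(** Inversion preserves length and changes the sign of the second coordinate. *)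
Lemma card_sphere_upward N :
  (#|` fset_set (@sphere n N)| <= 2 * #|` fset_set (slice upward N)|)%N.
Proof.
rewrite mul2n -addnn -[X in (_ <= _ + X)%N](size_map (@monoid.inv (BS n))) -size_cat.
apply: uniq_leq_size; first exact: fset_uniq.
move=> g; rewrite in_fset_set ?inE; last exact: finite_sphere.
move=> gN; rewrite mem_cat; case: (leP 0 (coord_k g)) => g0.
  by apply/orP; left; rewrite in_fset_set ?inE //; exact: finite_slice.
apply/orP; right; apply/mapP; exists g^-1%g; last by rewrite invgK.
rewrite in_fset_set ?inE; last exact: finite_slice.
by split; [rewrite /upward /= (coord_kV n2) oppr_ge0 ltW | rewrite /sphere /= bs_lengthV].
Qed.

Lemma card_long_ascents N :
  (2 * #|` fset_set (slice long_ascents N)| <= #|` fset_set (@sphere n N)|)%N.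
Proof.
rewrite mul2n -addnn -[X in (_ + X <= _)%N](size_map (@monoid.inv (BS n))) -size_cat.
have kpos g : g \in fset_set (slice long_ascents N) -> 0 < coord_k g.
  rewrite in_fset_set ?inE; last exact: finite_slice.
  by move=> [[y [K [-> K0 _ _]]] _]; rewrite (coord_ascent n2 _ _).1.
apply: uniq_leq_size.
  rewrite cat_uniq map_inj_uniq ?fset_uniq; last exact: invg_inj.
  rewrite andbT /=; apply/hasPn => _ /mapP[g /kpos gA ->].
  apply/negP => /kpos; rewrite (coord_kV n2); lia.
move=> g; rewrite mem_cat => gA; rewrite in_fset_set ?inE; last exact: finite_sphere.
case/orP: gA => [|/mapP[h + ->]]; rewrite in_fset_set ?inE; try exact: finite_slice.
  by case.
by case=> _; rewrite /sphere /= bs_lengthV.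
Qed.

(** Deleting the first letter of a geodesic leaves a geodesic. *)
Lemma card_sphereS N :
  (#|` fset_set (@sphere n N.+1)| <= 4 * #|` fset_set (@sphere n N)|)%N.
Proof.
have -> : 4%N = size [:: let_a; let_a'; let_t; let_t'] by [].
rewrite -(size_allpairs (fun x h => (bs_class n [:: x] * h)%g)).
apply: uniq_leq_size; first exact: fset_uniq.
move=> g; rewrite in_fset_set ?inE; last exact: finite_sphere.
move=> gN; have {}gN : bs_length g = N.+1 by [].
have [[|x w] sw wg] := bs_length_word g.
  by rewrite -sw in gN.
apply/(@allpairsP (bool * bool)%type); exists (x, bs_class n w); split.
- by case: x {wg sw} => [[] []].
- rewrite in_fset_set ?inE; last exact: finite_sphere.
  have := bs_length_class n w; have := bs_lengthM (bs_class n [:: x]) (bs_class n w).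
  have := bs_length_class n [:: x].
  by rewrite bs_mulE wg /sphere /=; move: sw => /=; lia.
- by rewrite bs_mulE wg.
Qed.

Lemma card_sphereD N c :
  (#|` fset_set (@sphere n (N + c))| <= 4 ^ c * #|` fset_set (@sphere n N)|)%N.
Proof.
elim: c => [|c IH]; first by rewrite addn0 mul1n.
by rewrite addnS; have := card_sphereS (N + c); rewrite expnS; lia.
Qed.

Lemma card_sphere_gt0 N : (0 < #|` fset_set (@sphere n N)|)%N.
Proof.
rewrite cardfs_gt0; apply/fset0Pn; exists (t ^+ N)%g.
by rewrite in_fset_set ?inE /sphere /= ?(bs_length_tX n2) //; exact: finite_sphere.
Qed.

Lemma long_ascents_density (R : realType) : positive_density R long_ascents.
Proof.
have [c [c_gt0 growth]] : exists c, (0 < c)%N /\ forall N,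
    (#|` fset_set (@sphere n (N + 13))| <= c * #|` fset_set (@sphere n N)|)%N.
  exists (4 ^ 13)%N; split; first by rewrite expn_gt0.
  by move=> N; exact: card_sphereD.
have c1 : 1 <= c%:R :> R by rewrite ler1n.
(* Growth over 13 steps costs the factor c and inversion a factor 2, so the ratio
   is at least 1 / (2 c). *)
exists (c%:R^-1 / 4); split; first by rewrite !mulr_gt0 ?invr_gt0; lra.
exists 13%N => N N13; rewrite -(subnK N13); move: (N - 13)%N => {N13}N.
have S0 := card_sphere_gt0 (N + 13).
have h1 := growth N.
have h2 := card_upward N.
have h3 := card_sphere_upward N.
have h4 := card_long_ascents (N + 13).
move: #|` _| #|` _| #|` _| #|` _| S0 h1 h2 h3 h4 => A U B S S0 hSB hUA hBU hAS.
have SA : S%:R <= c%:R * (2 * A%:R) :> R.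
  rewrite -!natrM ler_nat; apply: leq_trans hSB _.
  by rewrite leq_mul2l; apply/orP; right; apply: leq_trans hBU _; rewrite leq_mul2l hUA orbT.
have AS : 2 * A%:R <= S%:R :> R by rewrite -natrM ler_nat.
have {}S0 : 0 < S%:R :> R by rewrite ltr0n.
rewrite ltr_pdivlMr // ltr_pdivrMr //.
move: (c%:R : R) c1 SA => {c_gt0 growth hSB}c c1 SA.
have c0 : 0 < c by lra.
have ci0 : 0 < c^-1 by rewrite invr_gt0.
have ci1 : c^-1 <= 1 by rewrite invf_le1.
have SA' : c^-1 * S%:R <= 2 * A%:R by rewrite ler_pdivrMl.
have SS : c^-1 * S%:R <= S%:R by rewrite ler_piMl // ltW.
have cS : 0 < c^-1 * S%:R by rewrite mulr_gt0.
rewrite mulrBl mul1r [c^-1 / 4 * _]mulrAC; move: (c^-1 * S%:R) SA' SS cS => x *.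
by apply/andP; split; lra.
Qed.

End Density.

Theorem theorem5p17 (R : realType) (n r : nat)
  (hn : (3 <= n)%N) (hr1 : (1 <= r)%N) (hr2 : (r <= maxn 1 (n %/ 2 - 2))%N) :
  exists A : set (BS n),
    positive_density R A /\
    forall g : BS n, A g -> conj_curvature R r g < 0.
Proof.
exists (@long_ascents n); split; first exact: long_ascents_density.
move=> g [y [K [-> K0 yK yn]]].
have tr := bs_length_tX hn r.
apply: (conj_curvature_lt0 _ _ _ tr).
- by rewrite (bs_length_ascent hn) // addn_gt0 K0.
- move=> p; have [u [z [_ h]]] := conj_ascent_length hn p K0 yK.
  by rewrite (bs_length_ascent hn) //; lia.
- exact: conj_t_ascent_length.
Qed.
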